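(* Let $Q$ be a finite $3$-graph that is sparse and satisfies $\Delta_2(Q)\le 2$. Then $\lambda(\operatorname{cone}(Q))\le 4/9$.
   Context: A $3$-graph $H$ is a set of $3$-element subsets of a finite vertex set $V(H)$. For $\mathbf x=(x_i)_{i\in V(H)}$, the normalized Lagrangian polynomial is $p_H(\mathbf x)=6\sum_{ijk\in H}x_ix_jx_k$, and the normalized Lagrangian is $\lambda(H)=\max\{p_H(\mathbf x): x_i\ge 0,\ \sum_i x_i=1\}$. For distinct vertices $u,v$, $d_Q(u,v)=|\{w: uvw\in Q\}|$, and $\Delta_2(Q)=\max_{u\ne v}d_Q(u,v)$. $Q$ is sparse if for every $S\subseteq V(Q)$ with $|S|\ge 2$, the induced subgraph satisfies $|Q[S]|\le |S|-2$. The cone of $Q$ is the $3$-graph on $V(Q)\cup\{v_0\}$ ($v_0\notin V(Q)$ a new vertex) with edge set $Q\cup\{v_0uv: u,v\in V(Q),\ u\ne v\}$. *)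

(* Defs.v *)
From mathcomp Require Import all_boot all_order all_algebra.
From mathcomp Require Import all_classical all_reals all_analysis.
Import Order.TTheory GRing.Theory Num.Theory.
Import numFieldTopology.Exports numFieldNormedType.Exports.

Set Implicit Arguments.
Unset Strict Implicit.
Unset Printing Implicit Defensive.

Local Open Scope set_scope.
Local Open Scope ring_scope.

(* A 3-graph on the finite vertex type V is its edge set H, subject to
   [is_3graph H]; V plays the role of V(H), so isolated vertices are allowed. *)
Definition is_3graph (V : finType) (H : {set {set V}}) : Prop :=
  forall e : {set V}, e \in H -> #|e| = 3%N.

(* The sum is over unordered edges: each ijk in H contributes x_i x_j x_k once. *)
Definition lagrangian_poly (R : realType) (V : finType) (H : {set {set V}})
    (x : V -> R) : R :=
  6 * \sum_(e in H) \prod_(i in e) x i.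

Definition simplex (R : realType) (V : finType) (x : V -> R) : Prop :=
  (forall i, 0 <= x i) /\ \sum_i x i = 1.

(* For nonempty V the supremum is attained, see [lagrangian_max] below; for
   empty V the simplex is empty and the value is the conventional sup of the
   empty set, 0. *)
Definition lagrangian (R : realType) (V : finType) (H : {set {set V}}) : R :=
  sup [set lagrangian_poly H x | x in @simplex R V]%classic.

Arguments lagrangian R {V} H.

Definition codegree (V : finType) (Q : {set {set V}}) (u v : V) : nat :=
  #|[set w | [set u; v; w] \in Q]|.

Definition max_codegree (V : finType) (Q : {set {set V}}) : nat :=
  (\max_(p : V * V | p.1 != p.2) codegree Q p.1 p.2)%N.

Definition induced (V : finType) (Q : {set {set V}}) (S : {set V}) :
    {set {set V}} := [set e in Q | e \subset S].

Definition sparse (V : finType) (Q : {set {set V}}) : Prop :=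
  forall S : {set V}, (2 <= #|S|)%N -> (#|induced Q S| <= #|S| - 2)%N.

(* The vertex set of the cone is [option V], with [None] the new vertex v_0. *)
Definition cone (V : finType) (Q : {set {set V}}) : {set {set option V}} :=
  [set Some @: e | e : {set V} in Q]
  :|: [set [set None; Some p.1; Some p.2] | p : V * V & p.1 != p.2].

Lemma cone_is_3graph (V : finType) (Q : {set {set V}}) :
  is_3graph Q -> is_3graph (cone Q).
Proof.
move=> Q3 e; rewrite inE => /orP[/imsetP[f fQ ->]|/imsetP[[u v]]].
  by rewrite card_imset ?Q3//; exact: Some_inj.
rewrite inE/= => uv ->.
by rewrite -finset.setUA cardsU1 !inE/= cards2 (inj_eq Some_inj) uv.
Qed.

Lemma lagrangian_max (R : realType) (V : finType) (v : V) (H : {set {set V}}) :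
  exists2 c : V -> R, simplex c &
    lagrangian R H = lagrangian_poly H c /\
    forall x : V -> R, simplex x -> lagrangian_poly H x <= lagrangian_poly H c.
Proof.
Local Open Scope classical_set_scope.
pose T := {ptws V -> R}.
have proj_cont i : continuous (fun x : T => x i).
  exact: (@proj_continuous V (fun=> R) i).
have sumC (I : finType) (P : pred I) (F : I -> T -> R) :
    (forall i, P i -> continuous (F i)) ->
    continuous (fun x : T => \sum_(i | P i) F i x).
  by move=> FC; apply: continuous_big => //; exact: add_continuous.
have prodC (I : finType) (P : pred I) (F : I -> T -> R) :
    (forall i, P i -> continuous (F i)) ->
    continuous (fun x : T => \prod_(i | P i) F i x).
  by move=> FC; apply: continuous_big => //; exact: mul_continuous.
have polyC : continuous (lagrangian_poly H : T -> R).
  have sC : continuous (fun x : T => \sum_(e in H) \prod_(i in e) x i).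
    by apply: sumC => e _; apply: prodC => i _; exact: proj_cont.
  move=> x; rewrite /lagrangian_poly.
  exact: (@cvgM _ T (nbhs x) _ (cst 6) _ _ _ (cvg_cst _) (sC x)).
pose D : set T := @simplex R V.
have D0 : D !=set0.
  exists (fun i => (i == v)%:R); split=> [i|]; first exact: ler0n.
  by rewrite (bigD1 v)//= eqxx big1 ?addr0// => i /negbTE ->.
have Dc : compact D.
  apply: (@subclosed_compact _ _ [set f : T | forall i, `[0, 1]%classic (f i)]).
  - have -> : D = (\bigcap_(i in [set: V]) ((fun x : T => x i) @^-1` [set r | 0 <= r]))
                `&` ((fun x : T => \sum_i x i) @^-1` [set r | r = 1]).
      apply/seteqP; split=> x [x0 x1]; split=> // i; last exact: (x0 i I).
      by move=> _; exact: x0.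
    apply: closedI.
      apply: closed_bigI => i _.
      by apply: (proj1 (continuous_closedP _)) (proj_cont i) _ _; exact: closed_ge.
    apply: (proj1 (continuous_closedP _)) _ _ _; last exact: closed_eq.
    by apply: sumC => i _; exact: proj_cont.
  - by apply: (@tychonoff V (fun=> R) (fun=> `[0, 1]%classic)) => i; exact: segment_compact.
  - move=> x [x0 x1] i /=; rewrite in_itv/= x0 -x1 (bigD1 i)//= lerDl.
    by apply: sumr_ge0 => j _.
have [c cD cmax] := compact_EVT_max D0 Dc (continuous_subspaceT polyC).
have {}cmax x : simplex x -> lagrangian_poly H x <= lagrangian_poly H c.
  by move=> xD; apply: cmax; exact/mem_set.
exists c; first exact/set_mem.
split=> //; apply/eqP; rewrite eq_le; apply/andP; split.
  apply: ge_sup; first exact: image_nonempty.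
  by move=> _ [x xD <-]; exact: cmax.
apply: ub_le_sup; last by exists c => //; exact/set_mem.
by exists (lagrangian_poly H c) => _ [x xD <-]; exact: cmax.
Qed.

(* Main.v *)
Require Import Defs.
From mathcomp Require Import all_boot all_order all_algebra.
From mathcomp Require Import all_classical all_reals all_analysis.
From mathcomp Require Import ring lra fintype finset.
Import Order.TTheory GRing.Theory Num.Theory.

Local Open Scope ring_scope.

(** Put [P] for the sum of the edge products of a point [y] of the simplex on
    [V(Q)] and [s] for the sum of the [y_v ^ 2].  Optimizing over the weight of
    the apex, the cone bound follows from [4 P <= s (1 - s)].

    If a weight [W e] of the edges is dominated by [h v] at each vertex [v] of
    [e], sparsity gives that the sum of [W] is at most the sum of [h] over all
    vertices but two prescribed ones, here those with the two largest
    coordinates [a] and [b].  With [h = a b y] this gives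
    [P <= a b (1 - a - b)].  With [h = 4 c^2 y^2] and the AM-GM inequality
    between a coordinate and the product of the two others in the edge, whose
    squares sum to at most [s^2] by the codegree bound, it gives
    [4 c d P <= 4 c^2 r + d^2 s^2], where [r = s - a^2 - b^2].  The second bound
    with [c = 2 s], [d = 1 - s] settles the case [16 r <= (1 - s)^2]; otherwise
    either [s] is not small or [a^2 + b^2] is well below [s], and the first
    bound suffices. *)

(** * Polynomial inequalities in the coordinates and their power sums *)

Section NumericBounds.
Variable R : realType.
Implicit Types a b s w z : R.

(** Replacing [a] and [b] by their mean [m] does not decrease the product, and the last hypothesis
    then bounds [2 m^2] by [s - (1 - s)^2 / 16]. *)
Lemma top_product_le_small a b s : 0 <= a -> 0 <= b -> a + b <= 1 ->
  s <= 1 / 5 -> 0 <= s -> (1 - s) ^+ 2 <= 16 * (s - a ^+ 2 - b ^+ 2) ->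
  4 * (a * b * (1 - a - b)) <= s * (1 - s).
Proof.
move=> a0 b0 ab1 s5 s0 hs; pose m := (a + b) / 2.
have abm : a * b <= m ^+ 2 by rewrite /m; have := sqr_ge0 (a - b); nra.
have mq : 2 * m ^+ 2 <= a ^+ 2 + b ^+ 2.
  by rewrite /m; have := sqr_ge0 (a - b); nra.
have -> : 1 - a - b = 1 - 2 * m by rewrite /m; field.
have m0 : 0 <= m by rewrite /m; lra.
have m1 : 0 <= 1 - 2 * m by rewrite /m; lra.
have h1 : a * b * (1 - 2 * m) <= m ^+ 2 * (1 - 2 * m) by rewrite ler_wpM2r.
(* tangent line of [u |-> u (1 - 2 sqrt u)] at [u = (21/100)^2] *)
have h2 : 0 <= (m - 21 / 100) ^+ 2 * (2 * m + 21 / 100).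
  by rewrite mulr_ge0 ?sqr_ge0//; lra.
(* Equivalent to [4 s / 5 <= s (1 - s)]. *)
have h3 : 0 <= s * (1 / 5 - s) by rewrite mulr_ge0//; lra.
nra.
Qed.

Lemma top_product_le27 a b : 0 <= a -> 0 <= b -> a + b <= 1 ->
  27 * (a * b * (1 - a - b)) <= 1.
Proof.
move=> a0 b0 ab1; pose m := (a + b) / 2.
have abm : a * b <= m ^+ 2 by rewrite /m; have := sqr_ge0 (a - b); nra.
have -> : 1 - a - b = 1 - 2 * m by rewrite /m; field.
have m0 : 0 <= m by rewrite /m; lra.
have m1 : 0 <= 1 - 2 * m by rewrite /m; lra.
have h1 : a * b * (1 - 2 * m) <= m ^+ 2 * (1 - 2 * m) by rewrite ler_wpM2r.
have h2 : 0 <= (m - 1 / 3) ^+ 2 * (2 * m + 1 / 3).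
  by rewrite mulr_ge0 ?sqr_ge0//; lra.
nra.
Qed.

(** Optimizing over [b] leaves [a (1 - a)^2] on the left. The last hypothesis reads
    [2 a (1 - a) <= 1 - s], which suffices since [4 / 5 <= s]. *)
Lemma top_product_le_large a b s : 0 <= a -> 0 <= b -> a + b <= 1 ->
  4 / 5 <= s -> s <= a ^+ 2 + (1 - a) ^+ 2 ->
  4 * (a * b * (1 - a - b)) <= s * (1 - s).
Proof.
move=> a0 b0 ab1 s5 hs.
have h1 : 4 * (b * (1 - a - b)) <= (1 - a) ^+ 2.
  by have := sqr_ge0 (1 - a - 2 * b); nra.
have h2 : a * (4 * (b * (1 - a - b))) <= a * (1 - a) ^+ 2 by rewrite ler_wpM2l.
have h3 : 0 <= a * (1 - a) by rewrite mulr_ge0//; lra.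
have h4 : 0 <= a * (1 - a) * a by rewrite mulr_ge0.
have h5 : 4 / 5 * (1 - s) <= s * (1 - s) by rewrite ler_wpM2r//; nra.
nra.
Qed.

(** Here [w] stands for the total weight of [V(Q)] and [1 - w] for that of the apex. *)
Lemma cone_poly_le P s w : 0 < w -> w <= 1 -> 0 <= s -> s <= w ^+ 2 ->
  4 * w * P <= s * (w ^+ 2 - s) -> 6 * P + 3 * (1 - w) * (w ^+ 2 - s) <= 4 / 9.
Proof.
move=> w0 w1 s0 sw hP.
(* This choice turns [hP] into [2 P <= (w - z) (w^2 - s)], so the left side is at most
   [3 (1 - z) (w^2 - s)]. Also [w^2 - s = z^2 - (w - z)^2], and [3 (1 - z) z^2] peaks on [[0, 1]] at
   [z = 2 / 3] with value [4 / 9]. *)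
pose z := w - s / (2 * w).
have es : s = 2 * w * (w - z) by rewrite /z; field; lra.
have wz : z <= w by nra.
have zw : w <= 2 * z by nra.
have hP2 : 2 * P <= (w - z) * (w ^+ 2 - s).
  rewrite -(ler_pM2l w0); nra.
have zz : w ^+ 2 - s <= z ^+ 2 by rewrite es; have := sqr_ge0 (w - z); nra.
have h : (1 - z) * (w ^+ 2 - s) <= (1 - z) * z ^+ 2 by rewrite ler_wpM2l//; lra.
have h2 : 0 <= (z - 2 / 3) ^+ 2 * (z + 1 / 3).
  by rewrite mulr_ge0 ?sqr_ge0//; lra.
nra.
Qed.

End NumericBounds.

(** * Weighted consequences of sparsity *)

Section SparseTripleSystems.
Variables (R : realType) (V : finType) (Q : {set {set V}}).
Hypotheses (hQ : is_3graph Q) (hsparse : sparse Q).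
Hypothesis hcodeg : (max_codegree Q <= 2)%N.
Implicit Types (y h : V -> R) (W : {set V} -> R) (S : {set V}).

(** A set of size at least 2 loses at most two elements, and a smaller one spans no edge. In this
    form [u] and [v] stay fixed while [S] shrinks. *)
Lemma card_induced_le (u v : V) S : u != v ->
  (#|Defs.induced Q S| <= #|S :\: [set u; v]|)%N.
Proof.
move=> uv; have [S2|S2] := leqP 2 #|S|.
  rewrite (leq_trans (hsparse _ S2))// cardsD leq_sub2l//.
  by rewrite (leq_trans (subset_leq_card (subsetIr _ _)))// cards2 uv.
rewrite (_ : Defs.induced Q S = set0) ?cards0//.
apply/eqP; rewrite -subset0; apply/subsetP => e; rewrite !inE.
move=> /andP[eQ eS].
by have := subset_leq_card eS; rewrite (hQ _ eQ) leqNgt (leq_trans S2).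
Qed.

(* Layer-cake summation of the sparsity bounds on the superlevel sets of [h]. *)
Lemma sum_induced_le (u v : V) S (c : R) W h : u != v ->
  (forall w, w \in S -> c <= h w) ->
  (forall e w, e \in Q -> w \in e -> W e <= h w) ->
  \sum_(e in Defs.induced Q S) (W e - c) <= \sum_(w in S :\: [set u; v]) (h w - c).
Proof.
move=> uv; have [n] := ubnP #|S|; elim: n => // n IH in S c *.
rewrite ltnS => Sn ch Wh.
have [->|[k0 k0S]] := set_0Vmem S.
  rewrite big1 ?sumr_ge0// => [w|e]; first by rewrite !inE andbF.
  rewrite !inE subset0 => /andP[eQ /eqP e0].
  by have := hQ _ eQ; rewrite e0 cards0.
(* Raise the level from [c] to the minimum [h k]: each term drops by [h k - c], and
   [card_induced_le] compares the numbers of terms. At the new level [k] contributes nothing and the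
   edges through [k] at most 0, so [k] can be deleted. *)
case: (Order.TotalTheory.arg_minP h k0S) => k kS kmin.
have Sk : (#|S :\ k| < n)%N by move: Sn; rewrite (cardsD1 k S) (kS : k \in S).
have := IH (S :\ k) (h k) Sk.
move=> /(_ _ Wh) IHk.
have {}IHk : \sum_(e in Defs.induced Q (S :\ k)) (W e - h k) <=
    \sum_(w in (S :\ k) :\: [set u; v]) (h w - h k).
  by apply: IHk => w; rewrite !inE => /andP[_ /kmin].
have split_c (I : finType) (A : {set I}) (F : I -> R) :
    \sum_(i in A) (F i - c) =
    \sum_(i in A) (F i - h k) + (h k - c) *+ #|A|.
  rewrite -sumr_const -big_split/=; apply: eq_bigr => i _; ring.
rewrite !split_c lerD//; last first.
  by rewrite ler_wpMn2l ?card_induced_le// subr_ge0 ch.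
have -> : \sum_(w in S :\: [set u; v]) (h w - h k) =
          \sum_(w in (S :\ k) :\: [set u; v]) (h w - h k).
  rewrite [LHS](bigID (pred1 k))/= big1 ?add0r => [|w /andP[_ /eqP->]].
    by apply: eq_bigl => w; rewrite !inE andbC; case: eqP => //=; rewrite ?andbF.
  by rewrite subrr.
apply: le_trans IHk.
rewrite (bigID (fun e : {set V} => k \in e))/= -[leRHS]add0r lerD//.
  by apply: sumr_le0 => e; rewrite !inE => /andP[/andP[eQ _] ke]; rewrite subr_le0 Wh.
rewrite (eq_bigl (mem (Defs.induced Q (S :\ k)))) => [|e]; first exact: lexx.
by rewrite !inE subsetD1 -andbA.
Qed.

Lemma sum_sparse_le (u v : V) W h : u != v -> (forall w, 0 <= h w) ->
  (forall e w, e \in Q -> w \in e -> W e <= h w) ->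
  \sum_(e in Q) W e <= \sum_w h w - h u - h v.
Proof.
move=> uv h0 Wh; have := sum_induced_le u v [set: V] 0 W h uv (fun w _ => h0 w) Wh.
have -> : Defs.induced Q [set: V] = Q.
  by apply/setP => e; rewrite !inE subsetT andbT.
under eq_bigr do rewrite subr0; move=> /le_trans; apply.
have -> : \sum_w h w = h u + (h v + \sum_(w | (w != u) && (w != v)) h w).
  by rewrite (bigD1 u)//= (bigD1 v)//= eq_sym.
under eq_bigr do rewrite subr0.
rewrite (eq_bigl (fun w => (w != u) && (w != v))) => [|w].
  by rewrite le_eqVlt; apply/orP; left; apply/eqP; ring.
by rewrite !inE andbT negb_or.
Qed.

Lemma edge_decomp (e : {set V}) v : e \in Q -> v \in e ->
  exists i j, [/\ i != v, j != v, i != j & e = [set v; i; j]].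
Proof.
move=> eQ ve; have := hQ _ eQ; rewrite (cardsD1 v) ve => /eqP.
rewrite add1n eqSS => /cards2P[i [j [ij E]]].
have : i \in e :\ v by rewrite E !inE eqxx.
have : j \in e :\ v by rewrite E !inE eqxx orbT.
rewrite !inE => /andP[jv _] /andP[iv _]; exists i, j; split=> //.
by rewrite -(setD1K ve) E setUA.
Qed.

Lemma big_set3 (T : Type) (idx : T) (op : Monoid.com_law idx) (F : V -> T) i j k :
  i != j -> i != k -> j != k ->
  \big[op/idx]_(v in [set i; j; k]) F v = op (F i) (op (F j) (F k)).
Proof.
move=> ij ik jk; rewrite -setUA big_setU1 ?inE ?negb_or ?ij//=.
by rewrite big_setU1 ?inE//= big_set1.
Qed.

Lemma codegree_le u v : u != v -> (codegree Q u v <= 2)%N.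
Proof.
move=> uv; apply: leq_trans hcodeg.
exact: (@bigop.bigmax_sup _ (u, v)).
Qed.

(** * Upper bounds on the edge sum of [Q] *)

Definition edge_pairs y (e : {set V}) : R :=
  \sum_(p : V * V | [&& p.1 \in e, p.2 \in e & p.1 != p.2]) (y p.1 * y p.2) ^+ 2.

(** Double counting: an ordered pair of distinct vertices lies in at most two edges. The diagonal of
    the expanded square is discarded. *)
Lemma sum_edge_pairs y :
  \sum_(e in Q) edge_pairs y e <= 2 * (\sum_v y v ^+ 2) ^+ 2.
Proof.
rewrite /edge_pairs (exchange_big_dep (fun p : V * V => p.1 != p.2))/=; last first.
  by move=> e p _ /and3P[].
rewrite [X in 2 * X]expr2 big_distrlr/= pair_big/= mulr_sumr.
rewrite [leRHS](bigID (fun p : V * V => p.1 != p.2))/= -[leLHS]addr0 lerD//; last first.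
  apply: sumr_ge0 => p _; apply: mulr_ge0 => //.
  by apply: mulr_ge0; exact: sqr_ge0.
apply: ler_sum => -[u v]/= uv; rewrite sumr_const -exprMn -[leLHS]mulr_natl.
rewrite ler_wpM2r ?sqr_ge0// ler_nat (leq_trans _ (codegree_le _ _ uv))//.
(* The edge determines [w]: with [w] equal to [u] or [v] the set would have only two elements. *)
rewrite /codegree -(card_in_imset (f := fun w => [set u; v; w])) /=; last first.
  move=> w w'; rewrite !inE => wQ w'Q E.
  have : w' \in [set u; v; w] by rewrite E !inE eqxx orbT.
  have := hQ _ w'Q; rewrite !inE; case: (eqVneq w' u) => [->|w'u].
    by rewrite -setUA setUC -setUA setUid setUC cards2 uv.
  case: (eqVneq w' v) => [->|w'v].
    by rewrite -setUA setUid cards2 uv.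
  by move=> _ /= /eqP.
apply: subset_leq_card; apply/subsetP => e; rewrite unfold_in/=.
move=> /and4P[eQ ue ve _]; have [i [j [iu ju ij E]]] := edge_decomp _ _ eQ ue.
move: ve; rewrite E !inE eq_sym (negPf uv)/= => /orP[] /eqP vE; apply/imsetP.
  by exists j; rewrite ?inE vE// -E.
by exists i; rewrite ?inE vE // setUAC// -E.
Qed.

Lemma lagrangian_sum_le_codeg y (u v : V) c d : u != v ->
  (forall w, 0 <= y w) ->
  4 * c * d * \sum_(e in Q) \prod_(i in e) y i <=
  4 * c ^+ 2 * (\sum_w y w ^+ 2 - y u ^+ 2 - y v ^+ 2)
  + d ^+ 2 * (\sum_w y w ^+ 2) ^+ 2.
Proof.
move=> uv y0.
(* The factor [1 / 2] is there because [edge_pairs] runs over ordered pairs and so counts each pair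
   of an edge twice. *)
pose W (e : {set V}) := 4 * c * d * \prod_(i in e) y i - d ^+ 2 / 2 * edge_pairs y e.
have := @sum_sparse_le u v W (fun w => 4 * c ^+ 2 * y w ^+ 2) uv.
have h0 w : 0 <= 4 * c ^+ 2 * y w ^+ 2 by have := sqr_ge0 (c * y w); nra.
have Wh e w : e \in Q -> w \in e -> W e <= 4 * c ^+ 2 * y w ^+ 2.
  move=> eQ we; have [i [j [iw jw ij E]]] := edge_decomp _ _ eQ we.
  rewrite /W.
  have -> : \prod_(i in e) y i = y w * (y i * y j).
    by rewrite E big_set3//= eq_sym.
  have pairs : 2 * (y i * y j) ^+ 2 <= edge_pairs y e.
    rewrite /edge_pairs (bigD1 (i, j))/=; last by rewrite E !inE !eqxx ij !orbT.
    rewrite (bigD1 (j, i))/=; last first.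
      by rewrite E !inE !eqxx !orbT/= xpair_eqE negb_and eq_sym ij.
    rewrite (mulrC (y j)) addrA -mulr2n mulr_natl lerDl sumr_ge0// => p _.
    exact: sqr_ge0.
  (* AM-GM: [4 c d y_w q <= 4 c^2 y_w^2 + d^2 q^2] with [q = y_i y_j] *)
  have := sqr_ge0 (2 * c * y w - d * (y i * y j)).
  have := ler_wpM2l (sqr_ge0 d) pairs; nra.
move=> /(_ h0 Wh); rewrite /W sumrB -!mulr_sumr.
have := ler_wpM2l (sqr_ge0 d) (sum_edge_pairs y).
nra.
Qed.

Lemma lagrangian_sum_le_top y (u v : V) : u != v ->
  (forall w, 0 <= y w) -> (forall w, y w <= y u) ->
  (forall w, w != u -> y w <= y v) ->
  \sum_(e in Q) \prod_(i in e) y i <= y u * y v * (\sum_w y w - y u - y v).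
Proof.
move=> uv y0 yu yv.
rewrite !mulrBr mulr_sumr; apply: sum_sparse_le => // [w|e w eQ we].
  by rewrite !mulr_ge0.
have [i [j [iw jw ij ->]]] := edge_decomp _ _ eQ we.
rewrite big_set3//= 1?eq_sym// mulrC ler_wpM2r//.
(* At most one of [i] and [j] is [u], so one of the two coordinates is at most [y v]. *)
have [iu|iu] := eqVneq i u; first by rewrite iu ler_wpM2l// yv// -iu eq_sym.
by rewrite mulrC ler_pM// yv.
Qed.

Lemma lagrangian_sum_le_simplex y : simplex y ->
  4 * \sum_(e in Q) \prod_(i in e) y i <=
  (\sum_w y w ^+ 2) * (1 - \sum_w y w ^+ 2).
Proof.
move=> [y0 y1]; set P := \sum_(e in Q) _; set s := \sum_w y w ^+ 2.
have y_le1 w : y w <= 1 by rewrite -y1 (bigD1 w)//= lerDl sumr_ge0.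
have s1 : s <= 1.
  by rewrite -y1; apply: ler_sum => w _; rewrite expr2 ler_piMl.
have s0 : 0 <= s by apply: sumr_ge0 => w _; exact: sqr_ge0.
have [x _] : exists x : V, true.
  case: (pickP (mem V)) => [x _|V0]; first by exists x.
  by move: y1; rewrite big_pred0// => /esym/eqP; rewrite oner_eq0.
case: (@Order.TotalTheory.arg_maxP _ R V x predT y isT) => u _ umax.
have yu w : y w <= y u by exact: umax.
case: (pickP [pred w | w != u]) => [x' /= x'u|u_only]; last first.
  rewrite /P big1 ?mulr0 ?mulr_ge0 ?subr_ge0// => e eQ.
  have : (#|e| <= 1)%N.
    rewrite -(cards1 u); apply/subset_leq_card/subsetP => w _.
    by rewrite !inE; have /= := u_only w; case: eqP.
  by rewrite (hQ _ eQ).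
case: (@Order.TotalTheory.arg_maxP _ R V x' (fun w => w != u) y x'u) => v vu yv.
have uv : u != v by rewrite eq_sym.
have hA := lagrangian_sum_le_top y u v uv y0 yu yv.
have hC := lagrangian_sum_le_codeg y u v (2 * s) (1 - s) uv y0.
rewrite y1 -/P -/s in hA hC.
have rest : \sum_w y w = y u + y v + \sum_(w | (w != u) && (w != v)) y w.
  by rewrite (bigD1 u)//= (bigD1 v)//= addrA.
have ab1 : y u + y v <= 1.
  by rewrite -y1 rest lerDl sumr_ge0.
have su : s <= y u ^+ 2 + (1 - y u) ^+ 2.
  rewrite /s (bigD1 u)//= lerD2l -y1 [X in X - y u](bigD1 u)//= addrAC subrr add0r.
  rewrite expr2 mulr_suml; apply: ler_sum => w wu.
  rewrite expr2 ler_wpM2l// (bigD1 w)//= lerDl sumr_ge0//.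
have yu0 := y0 u; have yv0 := y0 v.
have [s5|s5] := leP s (1 / 5).
  have [r|r] := leP (16 * (s - y u ^+ 2 - y v ^+ 2)) ((1 - s) ^+ 2); last first.
    have := @top_product_le_small R _ _ s yu0 yv0 ab1 s5 s0 (ltW r); lra.
  have spos : 0 < s.
    rewrite lt_neqAle s0 andbT eq_sym; apply/eqP => /eqP.
    rewrite psumr_eq0 => [/allP/= z|w _]; last exact: sqr_ge0.
    move: y1; rewrite big1 => [/esym/eqP|w _]; first by rewrite oner_eq0.
    by apply/eqP; have := z w (mem_index_enum _); rewrite sqrf_eq0.
  have pos : 0 < s * (1 - s) by rewrite mulr_gt0//; lra.
  (* By [r] the right side of [hC] is at most [2 (s (1 - s))^2]; half of [hC] is then the goal
     multiplied by [s (1 - s)]. *)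
  rewrite -(ler_pM2l pos).
  have := ler_wpM2l (sqr_ge0 s) r; nra.
have [s45|s45] := leP s (4 / 5).
  have := @top_product_le27 R _ _ yu0 yv0 ab1.
  (* In this range [s (1 - s) >= 4 / 25 > 4 / 27]. *)
  have : 0 <= (s - 1 / 5) * (4 / 5 - s) by rewrite mulr_ge0//; lra.
  nra.
have := @top_product_le_large R _ _ s yu0 yv0 ab1 (ltW s45) su; lra.
Qed.

(** Both sides are homogeneous of degree 4 in [y], so rescaling to the simplex is enough. *)
Lemma lagrangian_sum_le y : (forall w, 0 <= y w) -> 0 < \sum_w y w ->
  4 * (\sum_w y w) * \sum_(e in Q) \prod_(i in e) y i <=
  (\sum_w y w ^+ 2) * ((\sum_w y w) ^+ 2 - \sum_w y w ^+ 2).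
Proof.
move=> y0; set w := \sum_w y w => wpos.
have wn0 : w != 0 by rewrite gt_eqF.
pose z v := y v / w.
have yz v : y v = w * z v by rewrite /z mulrC divfK.
have sz : simplex z.
  split=> [v|]; first by rewrite divr_ge0// ltW.
  by rewrite -mulr_suml divff.
have -> : \sum_v y v ^+ 2 = w ^+ 2 * \sum_v z v ^+ 2.
  by rewrite mulr_sumr; apply: eq_bigr => v _; rewrite yz exprMn.
have -> : \sum_(e in Q) \prod_(i in e) y i =
          w ^+ 3 * \sum_(e in Q) \prod_(i in e) z i.
  rewrite mulr_sumr; apply: eq_bigr => e eQ.
  under eq_bigr do rewrite yz.
  by rewrite big_split/= prodr_const hQ.
have := ler_wpM2l (exprn_ge0 4 (ltW wpos)) (lagrangian_sum_le_simplex _ sz).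
by set a := \sum_(e in Q) _; set b := \sum_v z v ^+ 2; nra.
Qed.

(** * The Lagrangian polynomial of the cone *)

Lemma cone_poly_split (x : option V -> R) : (forall i, 0 <= x i) ->
  lagrangian_poly (cone Q) x <=
  6 * \sum_(e in Q) \prod_(i in e) x (Some i)
  + 3 * x None * ((\sum_v x (Some v)) ^+ 2 - \sum_v x (Some v) ^+ 2).
Proof.
move=> x0; rewrite /lagrangian_poly /cone.
set A := [set Some @: e | e : {set V} in Q].
set f := fun p : V * V => [set None; Some p.1; Some p.2].
set B := [set f p | p : V * V & p.1 != p.2].
have prod0 (e : {set option V}) : 0 <= \prod_(i in e) x i by exact: prodr_ge0.
have AB : \sum_(e in A :|: B) \prod_(i in e) x i <=
    \sum_(e in A) \prod_(i in e) x i + \sum_(e in B) \prod_(i in e) x i.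
  rewrite (bigID (mem A))/= lerD//.
    rewrite (eq_bigl (mem A)) => [|e]; first exact: lexx.
    by rewrite /= in_setU andbC; case: (e \in A).
  rewrite [leRHS](bigID (mem A))/= -[leLHS]add0r lerD ?sumr_ge0//.
  rewrite (eq_bigl (fun e => (e \in B) && (e \notin A))) => [|e]; first exact: lexx.
  by rewrite in_setU; case: (e \in A); rewrite ?andbF.
have EA : \sum_(e in A) \prod_(i in e) x i = \sum_(e in Q) \prod_(i in e) x (Some i).
  rewrite big_imset/=; last by move=> e e' _ _; apply: imset_inj; exact: Some_inj.
  by apply: eq_bigr => e _; rewrite big_imset// => i j _ _; exact: Some_inj.
(* Each apex edge comes from two ordered pairs, [(a, b)] and [(b, a)]; hence the coefficient 3 in
   place of 6 in the conclusion. *)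
have EB : 2 * \sum_(e in B) \prod_(i in e) x i <=
    x None * ((\sum_v x (Some v)) ^+ 2 - \sum_v x (Some v) ^+ 2).
  have -> : x None * ((\sum_v x (Some v)) ^+ 2 - \sum_v x (Some v) ^+ 2) =
      \sum_(p in [set p : V * V | p.1 != p.2]) x None * (x (Some p.1) * x (Some p.2)).
    rewrite -mulr_sumr; congr (_ * _).
    rewrite expr2 big_distrlr/= pair_big/= (bigID (fun p : V * V => p.1 == p.2))/=.
    have -> : \sum_(p : V * V | p.1 == p.2) x (Some p.1) * x (Some p.2) =
        \sum_v x (Some v) ^+ 2.
      rewrite (reindex (fun v : V => (v, v)))/=.
        by apply: eq_big => v; rewrite ?eqxx.
      by exists fst => // -[a b]; rewrite inE/= => /eqP ->.
    by rewrite addrAC subrr add0r; apply: eq_bigl => p; rewrite inE.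
  rewrite (partition_big_imset f)/= mulr_sumr -/B; apply: ler_sum => e.
  move=> /imsetP[[a b]]; rewrite inE/= => ab ->.
  rewrite (bigD1 (a, b))/= ?inE/= ?ab ?eqxx// (bigD1 (b, a))/=; last first.
    rewrite inE/= xpair_eqE negb_and eq_sym ab/= /f/=.
    by rewrite setUAC eqxx.
  rewrite addrA [X in _ <= X + _](_ : _ = 2 * \prod_(i in f (a, b)) x i).
    by rewrite lerDl sumr_ge0// => p _; rewrite !mulr_ge0.
  rewrite /f/= -setUA big_setU1 ?inE//= big_setU1 ?inE ?(inj_eq Some_inj)//= big_set1.
  ring.
have := AB; rewrite EA; lra.
Qed.

End SparseTripleSystems.

Theorem theorem3p1 (R : realType) (V : finType) (Q : {set {set V}})
    (hQ : is_3graph Q) (hsparse : sparse Q) (hcodeg : (max_codegree Q <= 2)%N) :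
  lagrangian R (cone Q) <= 4 / 9.
Proof.
have [c [c0 c1] [-> _]] := lagrangian_max R None (cone Q).
apply: le_trans (cone_poly_split R V Q c c0) _.
pose y v := c (Some v).
have y0 v : 0 <= y v by exact: c0.
have cN : c None = 1 - \sum_v y v.
  rewrite -c1 (bigD1 None)//= [X in _ + X - _](_ : _ = \sum_v y v) ?addrK//.
  rewrite (reindex_omap Some id)/=; last by case.
  by apply: eq_bigl => v; rewrite eqxx.
have := c0 None; rewrite cN subr_ge0 -/(y _) => w1.
have sw : \sum_v y v ^+ 2 <= (\sum_v y v) ^+ 2.
  rewrite [leRHS]expr2 mulr_suml; apply: ler_sum => v _.
  by rewrite expr2 ler_wpM2l// (bigD1 v)//= lerDl sumr_ge0.
have s0 : 0 <= \sum_v y v ^+ 2 by apply: sumr_ge0 => v _; exact: sqr_ge0.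
have : 0 <= \sum_v y v by exact: sumr_ge0.
rewrite le_eqVlt => /predU1P[w0|w0]; last first.
  apply: cone_poly_le => //.
  exact: (lagrangian_sum_le R V Q hQ hsparse hcodeg).
(* All the weight sits on the apex, so every term vanishes. *)
have yz v : y v = 0.
  apply/eqP; move/esym/eqP: w0; rewrite psumr_eq0// => /allP.
  exact: (fun h => h v (mem_index_enum _)).
rewrite -w0 big1 ?mulr0 ?add0r => [|e eQ].
  by rewrite big1 ?expr0n ?subrr ?mulr0// => v _; rewrite -/(y v) yz expr0n.
have /card_gt0P[v ve] : (0 < #|e|)%N by rewrite hQ.
by rewrite (bigD1 v)//= -/(y v) yz mul0r.
Qed.
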